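(* Let $\mathbb{F}$ be a field, let $\mathcal{E}$ be an evolution algebra over $\mathbb{F}$ and let $B=\{e_1,\ldots,e_n\}$ be a natural basis of $\mathcal{E}$. Then the following conditions are equivalent: (1) $\mathcal{E}$ is nil. (2) There are no oriented cycles in the graph $\Gamma(\mathcal{E},B)$. (3) The basis $B$ can be reordered so that the matrix of structural constants $A$ of $\mathcal{E}$ relative to the (reordered) basis $B$ is strictly upper triangular. (4) $\mathcal{E}$ is nilpotent.
   Context: An algebra over a field $\mathbb{F}$ (arbitrary) is a finite-dimensional $\mathbb{F}$-vector space with a bilinear multiplication (not necessarily associative or unital). An evolution algebra is an algebra $\mathcal{E}$ with a vector space basis $B=\{e_1,\ldots,e_n\}$ such that $e_ie_j=0=e_je_i$ for all $i\neq j$ (so $\mathcal{E}$ is commutative); such a basis is called a natural basis. Writing $e_i^2=\sum_{j=1}^n\alpha_{ij}e_j$ with $\alpha_{ij}\in\mathbb{F}$, the matrix $A=(\alpha_{ij})$ is the matrix of structural constants relative to $B$. The graph $\Gamma(\mathcal{E},B)$ is the directed graph with vertex set $V=\{1,\ldots,n\}$ and edge set $E=\{(i,j)\in V\times V:\alpha_{ij}\neq 0\}$ (loops are allowed, and a loop is an oriented cycle of length $1$). An element $x\in\mathcal{E}$ is nil if there is a positive integer $m$ such that $(\cdots((x\cdot x)\cdot x)\cdots x)=0$ ($m$ factors $x$). The algebra $\mathcal{E}$ is nil if every element of it is nil. Define $\mathcal{E}^1=\mathcal{E}$ and $\mathcal{E}^{k+1}=\sum_{i=1}^{k}\mathcal{E}^i\mathcal{E}^{k+1-i}$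 for $k\ge 1$, where the product of two subspaces is the linear span of the products of their elements. The algebra $\mathcal{E}$ is nilpotent if $\mathcal{E}^m=0$ for some positive integer $m$. *)

(* Defs.v *)
From HB Require Import structures.
From mathcomp Require Import all_boot all_order all_fingroup all_algebra.

Set Implicit Arguments.
Unset Strict Implicit.
Unset Printing Implicit Defensive.

Import GRing.Theory.
Local Open Scope ring_scope.

(* A finite-dimensional algebra, neither associative nor unital in general, is
   a vectType E together with a bilinear product mul. *)
Section Algebras.

Variables (F : fieldType) (E : vectType F) (mul : {bilinear E -> E -> E}).

(* The left-normed product (...((x x) x)...) x with m >= 1 factors; the value
   at m = 0 is junk. *)
Definition left_power (x : E) (m : nat) : E :=
  iter m.-1 (fun y => mul y x) x.

Definition nil_element (x : E) : Prop :=
  exists2 m, (0 < m)%N & left_power x m = 0.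

Definition nil_algebra : Prop := forall x : E, nil_element x.

(* The span of all products of elements of U and V. As for prodv in falgebra,
   bases of U and V are used so that the spanning family is finite; see
   subspace_mulP. *)
Definition subspace_mul (U V : {vspace E}) : {vspace E} :=
  <<[seq mul u v | u <- vbasis U, v <- vbasis V]>>%VS.

Lemma subspace_mulP (U V W : {vspace E}) :
  reflect (forall u v, u \in U -> v \in V -> mul u v \in W)
          (subspace_mul U V <= W)%VS.
Proof.
apply: (iffP idP) => [sUVW u v uU vV | UVW].
  apply: (subvP sUVW).
  rewrite (coord_vbasis uU) (coord_vbasis vV) linear_sumlz /=.
  apply: rpred_sum => i _; rewrite linearZl_LR rpredZ //= linear_sumr /=.
  apply: rpred_sum => j _; rewrite linearZr_LR rpredZ //=.
  by apply/memv_span/allpairs_f; rewrite mem_nth // size_tuple.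
apply/span_subvP => _ /allpairsP[[u v] [/= uU vV ->]].
by apply: UVW; apply: vbasis_mem.
Qed.

(* powers k is the list of the k successive powers of E, from the first to the
   k-th: the last entry of powers k.+1 is E itself when k = 0, and otherwise
   the sum of the products of the entries of powers k whose exponents add up to
   k.+1 (exponents are shifted by one in the indexing of the list). *)
Fixpoint powers (k : nat) : seq {vspace E} :=
  if k is k'.+1 then
    let s := powers k' in
    rcons s (if k' is 0 then fullv
             else \sum_(i < k') subspace_mul (nth 0%VS s i)
                                             (nth 0%VS s (k'.-1 - i)))%VS
  else [::].

(* The k-th power of E for k >= 1; the value at k = 0 is junk. *)
Definition algebra_power (k : nat) : {vspace E} := nth 0%VS (powers k) k.-1.

Lemma size_powers k : size (powers k) = k.
Proof. by elim: k => //= k IHk; rewrite size_rcons IHk. Qed.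

Lemma nth_powers k i :
  (i < k)%N -> nth 0%VS (powers k) i = algebra_power i.+1.
Proof.
elim: k => // k IHk; rewrite ltnS leq_eqVlt => /predU1P[-> //| lt_ik].
by rewrite -IHk //= nth_rcons size_powers lt_ik.
Qed.

Lemma algebra_power1 : algebra_power 1 = fullv.
Proof. by []. Qed.

Lemma algebra_powerS k : (0 < k)%N ->
  algebra_power k.+1 = (\sum_(1 <= i < k.+1)
    subspace_mul (algebra_power i) (algebra_power (k.+1 - i)))%VS.
Proof.
case: k => // k _; rewrite {1}/algebra_power.
have -> : powers k.+2 = rcons (powers k.+1) (\sum_(i < k.+1)
  subspace_mul (nth 0 (powers k.+1) i) (nth 0 (powers k.+1) (k - i)))%VS by [].
rewrite nth_rcons size_powers ltnn eqxx big_add1 succnK big_mkord.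
apply: eq_bigr => i _; have le_ik : (i <= k)%N by rewrite -ltnS.
by rewrite !nth_powers // ?ltnS ?leq_subr // subSS subSn.
Qed.

Definition nilpotent_algebra : Prop :=
  exists2 m, (0 < m)%N & algebra_power m = 0%VS.

Section NaturalBasis.

Variables (n : nat) (B : n.-tuple E).

Definition natural_basis : Prop :=
  basis_of fullv B /\
  (forall i j : 'I_n, i != j -> mul (tnth B i) (tnth B j) = 0).

Definition structure_matrix : 'M[F]_n :=
  \matrix_(i, j) coord B j (mul (tnth B i) (tnth B i)).

Definition graph_edge : rel 'I_n := fun i j => structure_matrix i j != 0.

Definition reorder (s : 'S_n) : n.-tuple E := [tuple tnth B (s i) | i < n].

End NaturalBasis.

End Algebras.

(* The list c = [:: v_1; ...; v_k] stands for the oriented cycle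
   v_1 -> ... -> v_k -> v_1, with k >= 1 and distinct vertices; a loop is the
   case k = 1. *)
Definition oriented_cycle (T : eqType) (e : rel T) (c : seq T) : Prop :=
  c != [::] /\ ucycle e c.

Definition strictly_upper_triangular (R : nmodType) n (A : 'M[R]_n) : Prop :=
  forall i j : 'I_n, (j <= i)%N -> A i j = 0.

(* Main.v *)
Require Import Defs.
From HB Require Import structures.
From mathcomp Require Import all_boot all_order all_fingroup all_algebra.

(** A cycle makes some nonempty vertex set closed under taking a predecessor;
    in a minimal such set [S] every vertex has exactly one predecessor, so all
    the left powers of [\sum_(i in S) e_i] have nonzero coordinates on [S] and
    that element is not nil. Without cycles, sorting the vertices by decreasing
    number of reachable vertices makes the matrix strictly upper triangular. In
    that case let [V k] be the span of the [e_i] with [i >= k]: the products of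
    [V k] with the whole algebra fall in [V k.+1], and one of the two exponents
    in a product contributing to the [m]-th power is at least [m / 2], so the
    [2 ^ k]-th power of the algebra is contained in [V k]. *)

Set Implicit Arguments.
Unset Strict Implicit.
Unset Printing Implicit Defensive.

Import GRing.Theory.
Local Open Scope ring_scope.

Section Graphs.

Variables (T : finType) (e : rel T).

Definition pred_closed (S : {set T}) :=
  [forall i in S, exists j in S, e j i].

Lemma pred_closed_image (S : {set T}) (p : T -> T) :
  {in S, forall i, p i \in S /\ e (p i) i} -> pred_closed (p @: S).
Proof.
move=> pP; apply/forall_inP => _ /imsetP[j jS ->].
have [pjS _] := pP j jS; have [_ epp] := pP _ pjS.
by apply/exists_inP; exists (p (p j)) => //; apply: imset_f.
Qed.

(** Any choice of predecessors inside [S] is a map whose image is again nonempty and closed, hence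
    all of [S] by minimality; such a map is therefore injective on [S]. *)
Lemma min_pred_closed_uniq (S : {set T}) :
  minset (fun X => pred_closed X && (X != set0)) S ->
  {in S & &, forall i j k, e i j -> e k j -> k = i}.
Proof.
move=> /minsetP[/andP[cS nS] minS] i j k iS jS kS eij ekj.
pose p0 x := odflt x [pick y in S | e y x].
have p0P x : x \in S -> p0 x \in S /\ e (p0 x) x.
  move=> xS; rewrite /p0; case: pickP => [y /andP[] // | no].
  have /exists_inP[y yS eyx] := forall_inP cS x xS.
  by have := no y; rewrite yS eyx.
(* The choices [p i] and [p k] differ only at [j]. If [i] is [p k x] with [x] other than [j], then
   [p i] takes the value [i] at both [x] and [j], against injectivity. *)
pose p z x := if x == j then z else p0 x.
have imp z : z \in S -> e z j -> p z @: S = S.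
  move=> zS ezj.
  have pP : {in S, forall x, p z x \in S /\ e (p z x) x}.
    by move=> x xS; rewrite /p; case: eqP => [-> | _]; last exact: p0P.
  apply: minS; first rewrite pred_closed_image //=.
    by apply/set0Pn; exists (p z j); apply: imset_f.
  by apply/subsetP => _ /imsetP[x xS ->]; case: (pP x xS).
have inj : {in S &, injective (p i)} by apply/imset_injP; rewrite imp.
have : i \in p k @: S by rewrite imp.
case/imsetP => x xS; rewrite {1}/p; case: eqP => [_ // | /eqP njx ipx].
case/eqP: njx; apply: inj => //.
by rewrite /p eqxx; case: eqP.
Qed.

Lemma cycle_pred_closed c : oriented_cycle e c ->
  pred_closed [set x in c] && ([set x in c] != set0).
Proof.
case=> nc /andP[cyc _]; apply/andP; split.
  apply/forall_inP => i; rewrite inE => ic; apply/exists_inP.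
  by exists (prev c i); rewrite ?inE ?mem_prev // prev_cycle.
by case: c nc {cyc} => // x c _; apply/set0Pn; exists x; rewrite inE mem_head.
Qed.

Lemma acyclic_connect : ~ (exists c, oriented_cycle e c) ->
  forall i j, e i j -> ~~ connect e j i.
Proof.
move=> nc i j eij; apply/negP => /connectP[q pathq Ei]; apply: nc.
(* A cycle must have distinct vertices, so the path from [j] to [i] is shortened before the edge
   from [i] to [j] closes it. *)
move: Ei; case/shortenP: pathq => q' pq' uq' _ Ei.
exists (j :: q'); split=> //; rewrite /ucycle uq' andbT /=.
by rewrite rcons_path pq' -Ei.
Qed.

(** The vertex [i] reaches itself but is not reachable from [j], so the inclusion of reachable sets
    is strict. *)
Lemma acyclic_reach_lt : ~ (exists c, oriented_cycle e c) ->
  forall i j, e i j -> (#|connect e j| < #|connect e i|)%N.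
Proof.
move=> nc i j eij; apply/proper_card/properP; split.
  by apply/subsetP => k; apply/connect_trans/connect1.
by exists i; [exact: connect0 | exact: acyclic_connect].
Qed.

End Graphs.

Lemma sort_perm n (h : 'I_n -> nat) :
  exists s : 'S_n, forall i j : 'I_n, (i <= j)%N -> (h (s j) <= h (s i))%N.
Proof.
pose r : rel 'I_n := fun i j => (h j <= h i)%N.
pose t := sort r (enum 'I_n).
have szt : size t == n by rewrite size_sort size_enum_ord.
have ut : uniq t by rewrite sort_uniq enum_uniq.
have inj : injective (tnth (Tuple szt)) by apply/tuple_uniqP.
exists (perm inj) => i j; rewrite !permE.
have rtr : transitive r by move=> y x z rxy ryz; exact: leq_trans ryz rxy.
have rre : reflexive r by move=> x; exact: leqnn.
have st : sorted r t by apply: sort_sorted => x y; exact: leq_total.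
rewrite !(tnth_nth i) => leij.
by apply: (sorted_leq_nth rtr rre i st) => //; rewrite inE (eqP szt).
Qed.

Section Algebras.

Variables (F : fieldType) (E : vectType F) (mul : {bilinear E -> E -> E}).

Lemma left_power_mem x k : left_power mul x k.+1 \in algebra_power mul k.+1.
Proof.
elim: k => [|k IHk]; first by rewrite algebra_power1 memvf.
(* The last summand is the product of the power of exponent [k.+1] with the whole algebra. *)
rewrite algebra_powerS // big_nat_recr //= subSnn.
apply: (subvP (addvSr _ _)); apply: (subspace_mulP _ _ _ _ (subvv _)) => //.
by rewrite algebra_power1 memvf.
Qed.

Lemma nilpotent_nil : nilpotent_algebra mul -> nil_algebra mul.
Proof.
case=> -[//|m] _ E0 x; exists m.+1 => //.
by apply/eqP; rewrite -memv0 -E0 left_power_mem.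
Qed.

Section NaturalBasis.

Variables (n : nat) (B : n.-tuple E).
Hypothesis natB : natural_basis mul B.

Local Notation e := (tnth B).
Local Notation A := (structure_matrix mul B).

Let coordE x : x = \sum_i coord B i x *: e i.
Proof.
rewrite {1}(coord_basis natB.1 (memvf x)).
by apply: eq_bigr => i _; rewrite (tnth_nth 0).
Qed.

Lemma coord_natural (i j : 'I_n) : coord B i (e j) = (j == i)%:R.
Proof. by rewrite (tnth_nth 0) coord_free // (basis_free natB.1). Qed.

Lemma natural_mulE x y :
  mul x y = \sum_i (coord B i x * coord B i y) *: mul (e i) (e i).
Proof.
rewrite {1}(coordE x) linear_sumlz; apply: eq_bigr => i _ /=.
rewrite linearZl_LR {1}(coordE y) linear_sumr (bigD1 i) //= big1 => [|j nji].
  by rewrite addr0 linearZr_LR scalerA.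
by rewrite linearZr_LR natB.2 ?scaler0 // eq_sym.
Qed.

Lemma coord_natural_mul j x y :
  coord B j (mul x y) = \sum_i coord B i x * coord B i y * A i j.
Proof.
rewrite natural_mulE linear_sum; apply: eq_bigr => i _.
by rewrite linearZ /= mxE.
Qed.

Lemma natural_mulC x y : mul x y = mul y x.
Proof. by rewrite !natural_mulE; apply: eq_bigr => i _; rewrite mulrC. Qed.

Lemma nil_acyclic : nil_algebra mul ->
  ~ (exists c : seq 'I_n, oriented_cycle (graph_edge mul B) c).
Proof.
move=> nilE [c /cycle_pred_closed closed_c].
pose P X := pred_closed (graph_edge mul B) X && (X != set0).
have [S minS _] := @minset_exists _ P _ closed_c.
have uniqS := min_pred_closed_uniq minS.
have /minsetP[/andP[cS /set0Pn[i0 i0S]] _] := minS.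
pose x := \sum_(i in S) e i.
have xE i : coord B i x = (i \in S)%:R.
  rewrite linear_sum /=; have [iS | niS] := boolP (i \in S).
    rewrite (bigD1 i) //= coord_natural eqxx big1 ?addr0 // => j /andP[_ nji].
    by rewrite coord_natural (negPf nji).
  by apply: big1 => j jS; rewrite coord_natural; case: eqP niS jS => // -> /negP.
have pow_neq0 k : {in S, forall i, coord B i (left_power mul x k.+1) != 0}.
  elim: k => [|k IHk] i iS; first by rewrite xE iS oner_eq0.
  rewrite [left_power _ _ _]/(mul (left_power mul x k.+1) x) coord_natural_mul.
  have /exists_inP[j jS eji] := forall_inP cS i iS.
  (* Only the predecessor [j] contributes, so nothing can cancel in any characteristic: [x] has
     coordinate 0 outside [S], and no other vertex of [S] has an edge to [i]. *)
  rewrite (bigD1 j) //= big1 => [|l nlj].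
    by rewrite addr0 xE jS mulr1 mulf_neq0 ?IHk.
  rewrite xE; have [lS | _] := boolP (l \in S); last by rewrite mulr0 mul0r.
  have [-> | Ali] := eqVneq (A l i) 0; first by rewrite mulr0.
  by rewrite (uniqS j i l jS iS lS eji Ali) eqxx in nlj.
have [[//|m] _ xm0] := nilE x.
by have := pow_neq0 m i0 i0S; rewrite xm0 linear0 eqxx.
Qed.

Lemma reorder_natural_basis (s : 'S_n) : natural_basis mul (reorder B s).
Proof.
split=> [|i j nij]; last by rewrite !tnth_mktuple natB.2 // (inj_eq perm_inj).
rewrite (perm_basis (Y := B)) ?natB.1 //; apply/tuple_permP.
by exists s.
Qed.

Lemma coord_reorder (s : 'S_n) (j : 'I_n) x :
  coord (reorder B s) j x = coord B (s j) x.
Proof.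
have freeBs := basis_free (reorder_natural_basis s).1.
(* Reindexed by [s], the expansion of [x] over [B] is one over the reordered basis, where
   coordinates are unique. *)
rewrite {1}(coordE x) (reindex_inj (@perm_inj _ s)) /=.
rewrite -[RHS](coord_sum_free (fun i => coord B (s i) x) j freeBs).
by congr (coord _ _ _); apply: eq_bigr => i _; rewrite -tnth_nth tnth_mktuple.
Qed.

Lemma structure_matrix_reorder (s : 'S_n) i j :
  structure_matrix mul (reorder B s) i j = A (s i) (s j).
Proof. by rewrite !mxE coord_reorder tnth_mktuple. Qed.

Lemma acyclic_triangular :
  ~ (exists c : seq 'I_n, oriented_cycle (graph_edge mul B) c) ->
  exists s : 'S_n,
    strictly_upper_triangular (structure_matrix mul (reorder B s)).
Proof.
move=> nc.
have [s sP] := sort_perm (fun i => #|connect (graph_edge mul B) i|).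
exists s => i j le_ji; rewrite structure_matrix_reorder.
(* A nonzero entry is an edge from [s i] to [s j], so [s j] would reach fewer vertices than [s i],
   against the sorting. *)
apply/eqP/negPn/negP => /(acyclic_reach_lt nc).
by rewrite ltnNge sP.
Qed.

End NaturalBasis.

Section Triangular.

Variables (n : nat) (B : n.-tuple E).
Hypothesis natB : natural_basis mul B.
Hypothesis triB : strictly_upper_triangular (structure_matrix mul B).

Let V k : {vspace E} := (\sum_(i < n | (k <= i)%N) <[tnth B i]>)%VS.

Let mem_V k (i : 'I_n) : (k <= i)%N -> tnth B i \in V k.
Proof. by move=> ki; rewrite memvE /V (sumv_sup i). Qed.

Let mem_sqr k (i : 'I_n) : (k <= i)%N -> mul (tnth B i) (tnth B i) \in V k.+1.
Proof.
move=> ki; rewrite (coord_basis natB.1 (memvf (mul _ _))).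
apply: rpred_sum => j _; have [le_ji | lt_ij] := leqP j i.
  by have := triB le_ji; rewrite mxE => ->; rewrite scale0r mem0v.
by rewrite -tnth_nth rpredZ // mem_V // (leq_ltn_trans ki).
Qed.

Let mem_mul k x y : x \in V k -> mul x y \in V k.+1.
Proof.
case/memv_sumP => v vP ->; rewrite linear_sumlz; apply: rpred_sum => i ki /=.
have /vlineP[a ->] := vP i ki; rewrite linearZl_LR rpredZ // (natural_mulE natB).
(* Multiplying a basis vector by any [y] gives a multiple of its square. *)
apply: rpred_sum => j _; rewrite (coord_natural natB).
have [<- | _] := eqVneq; first by rewrite rpredZ // mem_sqr.
by rewrite mul0r scale0r mem0v.
Qed.

Let power_sub k m : (2 ^ k <= m)%N -> (algebra_power mul m <= V k)%VS.
Proof.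
elim: k m => [|k IHk] m le_m.
  have -> : V 0 = fullv; last exact: subvf.
  apply/eqP; rewrite eqEsubv subvf /=.
  rewrite -(span_basis natB.1); apply/span_subvP => _ /tnthP[i ->].
  exact: mem_V.
have m1 : (1 < m)%N.
  by apply: leq_trans le_m; rewrite expnS leq_pmulr // expn_gt0.
case: m m1 le_m => // m m1 le_m; rewrite algebra_powerS //.
rewrite big_add1 big_mkord; apply/subv_sumP => i _.
apply/subspace_mulP => u v uP vP.
have [le_i | lt_i] := leqP (2 ^ k) i.+1; first exact/mem_mul/(subvP (IHk _ le_i)).
(* The left exponent is below [2 ^ k], so the right one is at least [2 ^ k]; commutativity brings
   that factor to the left, where [mem_mul] applies. *)
rewrite (natural_mulC natB); apply/mem_mul/(subvP (IHk _ _) _ vP).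
rewrite leq_subRL; last exact/leqW/ltn_ord.
by apply: leq_trans le_m; rewrite expnS mul2n -addnn leq_add2r ltnW.
Qed.

Lemma triangular_nilpotent : nilpotent_algebra mul.
Proof.
exists (2 ^ n)%N; first by rewrite expn_gt0.
apply/eqP; rewrite -subv0; apply: subv_trans (power_sub (leqnn _)) _.
(* No index is at least [n], so [V n] is an empty sum. *)
by rewrite /V big_pred0 ?subvv // => i; rewrite leqNgt ltn_ord.
Qed.

End Triangular.

End Algebras.

Theorem theorem3p4 (F : fieldType) (E : vectType F)
    (mul : {bilinear E -> E -> E}%R) (n : nat) (B : n.-tuple E)
    (natB : natural_basis mul B) :
  [<-> nil_algebra mul;
       ~ (exists c : seq 'I_n, oriented_cycle (graph_edge mul B) c);
       exists s : 'S_n,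
         strictly_upper_triangular (structure_matrix mul (reorder B s));
       nilpotent_algebra mul].
Proof.
tfae.
- exact: nil_acyclic.
- exact: acyclic_triangular.
- by case=> s; apply: triangular_nilpotent; apply: reorder_natural_basis.
- exact: nilpotent_nil.
Qed.
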